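(* For every $s\ge1$ and $\ell=1,\dots,g$, the column $n$-vector $I_{s,\ell}(z)$ of polynomials in $z$ is a solution modulo $p^{es}$ of the system of KZ equations $$\frac{\partial I}{\partial z_i}=\frac1q\sum_{j\ne i}\frac{\Omega_{ij}}{z_i-z_j}I,\quad i=1,\dots,n,\qquad I_1+\dots+I_n=0.$$
   Context: Let $p>q$ be prime numbers, $p$ odd, and let $e$ be the order of $p$ modulo $q$ (the least positive integer with $p^e\equiv1\pmod q$). Let $g$ be a positive integer and $n=gq+1$. Assume $p^e>n$ and $p\ge n+q-2$. Let $t$ be one variable and $z=(z_1,\dots,z_n)$. For $s\ge1$ put $\Phi_s(t,z)=\big((t-z_1)\cdots(t-z_n)\big)^{(p^{es}-1)/q}$. For $\ell=1,\dots,g$ the vector $I_{s,\ell}(z)=(I_{s,\ell,1},\dots,I_{s,\ell,n})$ is the coefficient of $t^{\ell p^{es}-1}$ in the column $n$-vector of polynomials $\big(\frac{\Phi_s(t,z)}{t-z_1},\dots,\frac{\Phi_s(t,z)}{t-z_n}\big)$. $\Omega_{ij}$ is the $n\times n$ matrix with entries $-1$ at positions $(i,i)$ and $(j,j)$, $1$ at positions $(i,j)$ and $(j,i)$, and $0$ elsewhere. Being a solution modulo $p^{es}$ means that in each equation the difference of the two sides is divisible by $p^{es}$ (in the ring $\mathbb Z_{(p)}[z,(z_i-z_j)^{-1}: i\ne j]$; note that $q$ is invertible modulo $p$). *)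

(* Defs.v *)
From HB Require Import structures.
From mathcomp Require Import all_boot all_order all_algebra.
From mathcomp Require Import mpoly.

Set Implicit Arguments.
Unset Strict Implicit.
Unset Printing Implicit Defensive.

Import GRing.Theory.
Local Open Scope ring_scope.

Definition is_order_mod (q p e : nat) : Prop :=
  [/\ (0 < e)%N, p ^ e = 1 %[mod q] &
      forall m : nat, (0 < m)%N -> p ^ m = 1 %[mod q] -> (e <= m)%N].

(* The variable t is the polynomial variable 'X over Z[z]. *)
Definition master (n N : nat) : {poly {mpoly int[n]}} :=
  (\prod_(i < n) ('X - ('X_i)%:P)) ^+ N.

(* Both divisions are exact when p ^ (e * s) = 1 mod q and p, q > 1, s, e > 0:
   q divides p ^ (e * s) - 1, and the quotient is positive. *)
Definition Phi (n p q e s : nat) : {poly {mpoly int[n]}} :=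
  master n ((p ^ (e * s) - 1) %/ q).

Definition Ivec (n p q e s l : nat) : 'cV[{mpoly int[n]}]_n :=
  \col_(i < n) (Phi n p q e s %/ ('X - ('X_i)%:P))`_(l * p ^ (e * s) - 1).

(* The field Q(z), in which all identities are read. *)
Notation ratfun n := {fraction {mpoly rat[n]}}.

Definition zvar (n : nat) (i : 'I_n) : ratfun n :=
  FracField.tofrac ('X_i : {mpoly rat[n]}).

Definition int_ratfun (n : nat) (P : {mpoly int[n]}) : ratfun n :=
  FracField.tofrac (map_mpoly (intr : int -> rat) P).

(* Z_(p) as a subring of Q. *)
Definition Zloc (p : nat) (c : rat) : Prop := ~~ (p %| `|denq c|)%N.

(* Z_(p)[z, (z_i - z_j)^-1 : i != j], the subring of Q(z) generated by Z_(p),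
   the z_i and the (z_i - z_j)^-1; opposites are products with -1 in Z_(p). *)
Inductive KZring (n p : nat) : ratfun n -> Prop :=
| KZring_const (c : rat) :
    Zloc p c -> KZring p (FracField.tofrac (c%:MP_[n]))
| KZring_var (i : 'I_n) : KZring p (zvar i)
| KZring_inv (i j : 'I_n) : i != j -> KZring p (zvar i - zvar j)^-1
| KZring_add (x y : ratfun n) : KZring p x -> KZring p y -> KZring p (x + y)
| KZring_mul (x y : ratfun n) : KZring p x -> KZring p y -> KZring p (x * y).

Definition KZdvd (n p M : nat) (x : ratfun n) : Prop :=
  exists2 y : ratfun n, KZring p y & x = M%:R * y.

Definition Omega (n : nat) (F : nzRingType) (i j : 'I_n) : 'M[F]_n :=
  \matrix_(a, b)
    if ((a, b) == (i, i)) || ((a, b) == (j, j)) then -1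
    else if ((a, b) == (i, j)) || ((a, b) == (j, i)) then 1
    else 0.

Definition KZrhs (n q : nat) (i : 'I_n) (I : 'cV[ratfun n]_n) :
    'cV[ratfun n]_n :=
  q%:R^-1 *: \sum_(j < n | j != i)
    ((zvar i - zvar j)^-1 *: Omega (ratfun n) i j) *m I.

Definition KZ_solution_mod (n p q M : nat) (I : 'cV[{mpoly int[n]}]_n) : Prop :=
  (forall i a : 'I_n,
     KZdvd p M (int_ratfun (I a 0)^`M(i)
                - KZrhs q i (map_mx (@int_ratfun n) I) a 0)) /\
  KZdvd p M (int_ratfun (\sum_(a < n) I a 0)).

(* Main.v *)
(* Write M = p^(es) = q N + 1 and A_a = Phi / (t - z_a).  For a != i put
   B = Phi / ((t - z_i) (t - z_a)); then A_i - A_a = (z_i - z_a) B and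
   dA_a/dz_i = - N B.  Hence the a-th coordinate of the i-th equation has defect
   - (N + 1/q) times a coefficient of B, i.e. - M/q times it.
   Since N (A_1 + ... + A_n) = dPhi/dt, the coefficient of t^(l M - 1) in
   A_1 + ... + A_n is l M / N times a coefficient of Phi, and p does not divide N.
   The right-hand side of each equation has coordinate sum 0, so the remaining
   coordinate a = i follows by summation. *)
Require Import Defs.
From HB Require Import structures.
From mathcomp Require Import all_boot all_order all_algebra.
From mathcomp Require Import mpoly.
From mathcomp Require Import ring.

(** * Divisibility by [M] in Z_(p)[z, 1/(z_i - z_j)] *)

Section KZRing.

Import GRing.Theory.
Local Open Scope ring_scope.
Set Implicit Arguments.
Unset Strict Implicit.

Variables (n p : nat).

HB.instance Definition _ := GRing.RMorphism.copy (@int_ratfun n)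
  (@FracField.tofrac {mpoly rat[n]} \o map_mpoly (intr : int -> rat)).

Let ratC : {rmorphism rat -> ratfun n} :=
  (@FracField.tofrac {mpoly rat[n]} \o @mpolyC n rat).

Lemma ratfun_natf_neq0 (N : nat) : (0 < N)%N -> N%:R != 0 :> ratfun n.
Proof.
by move=> N_gt0; rewrite -(rmorph_nat ratC) fmorph_eq0 Num.Theory.pnatr_eq0 -lt0n.
Qed.

Lemma int_ratfun_var (i : 'I_n) : int_ratfun ('X_i) = zvar i.
Proof. by rewrite /int_ratfun map_mpolyX. Qed.

Lemma zvar_sub_neq0 (i j : 'I_n) : i != j -> zvar i - zvar j != 0.
Proof.
move=> ij; rewrite subr_eq0 tofrac_eq; apply: contraNneq ij => Xij.
have := congr1 (mcoeff U_(i)) Xij; rewrite !mcoeffX eqxx.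
case: eqVneq => // /(congr1 (fun m : 'X_{1..n} => m i)).
by rewrite !mnm1E eqxx; case: eqVneq => // ->.
Qed.

Lemma Zloc_int (c : int) : prime p -> Zloc p c%:~R.
Proof. by rewrite /Zloc denq_int => /prime_gt1; case: p => [|[|]]. Qed.

Lemma Zloc_natV (N : nat) : ~~ (p %| N)%N -> Zloc p N%:R^-1.
Proof.
move=> pN; apply: contraNN pN => /dvdn_trans; apply.
have [->|N_neq0] := eqVneq N 0%N; first exact: dvdn0.
have := numqE (N%:R^-1 : rat); set x := N%:R^-1 => xE.
have NE : N%:R * (numq x)%:~R = (denq x)%:~R :> rat.
  by rewrite xE mulrA mulfV ?mul1r // Num.Theory.pnatr_eq0.
have /(congr1 absz) : N%:Z * numq x = denq x.
  by apply: (@intr_inj rat); rewrite rmorphM.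
rewrite abszM absz_nat => dE.
(* Coprimality with the numerator turns the denominator's dividing [N * numq x] into its dividing
   [N]. *)
have := coprime_num_den x; rewrite coprime_sym => /Gauss_dvdl <-.
by rewrite dE.
Qed.

Lemma KZring_natV (N : nat) : ~~ (p %| N)%N -> KZring p (N%:R^-1 : ratfun n).
Proof.
move=> pN; rewrite -(rmorph_nat ratC) -fmorphV.
by apply: KZring_const; apply: Zloc_natV.
Qed.

Hypothesis p_prime : prime p.

Lemma KZring_int (c : int) : KZring p (c%:~R : ratfun n).
Proof.
by rewrite -(rmorph_int ratC); apply: KZring_const; apply: Zloc_int.
Qed.

Lemma KZring_opp (x : ratfun n) : KZring p x -> KZring p (- x).
Proof.
by move=> px; rewrite -mulN1r; apply: KZring_mul => //; apply: (KZring_int (-1)).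
Qed.

Lemma KZring_int_ratfun (P : {mpoly int[n]}) : KZring p (int_ratfun P).
Proof.
rewrite [P]mpolyE rmorph_sum; elim/big_ind: _ => [|x y|m _].
- exact: (KZring_int 0).
- exact: KZring_add.
rewrite -mul_mpolyC rmorphM; apply: KZring_mul.
  by rewrite /= /int_ratfun map_mpolyC; apply: KZring_const; apply: Zloc_int.
rewrite mpolyXE_id rmorph_prod; elim/big_ind: _ => [|x y|i _].
- exact: (KZring_int 1).
- exact: KZring_mul.
rewrite rmorphXn /= int_ratfun_var; elim: (m i) => [|k IHk].
  exact: (KZring_int 1).
by rewrite exprS; apply: KZring_mul IHk; apply: KZring_var.
Qed.

Variable M : nat.

Lemma KZdvd_add (x y : ratfun n) :
  KZdvd p M x -> KZdvd p M y -> KZdvd p M (x + y).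
Proof.
move=> [u pu ->] [v pv ->]; exists (u + v); last by rewrite mulrDr.
exact: KZring_add.
Qed.

Lemma KZdvd_opp (x : ratfun n) : KZdvd p M x -> KZdvd p M (- x).
Proof.
by move=> [u pu ->]; exists (- u); [apply: KZring_opp | rewrite mulrN].
Qed.

Lemma KZdvd_sum (I : finType) (P : pred I) (F : I -> ratfun n) :
  (forall i, P i -> KZdvd p M (F i)) -> KZdvd p M (\sum_(i | P i) F i).
Proof.
move=> dvdF; elim/big_ind: _ => //; last exact: KZdvd_add.
by exists 0; [apply: (KZring_int 0) | rewrite mulr0].
Qed.

(** A factor [N] prime to p is a unit of Z_(p) and can be cancelled. This serves identities
    available only after multiplication by (p^(es) - 1)/q. *)
Lemma KZdvd_int_ratfun (N : nat) (P Q : {mpoly int[n]}) :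
  (0 < N)%N -> ~~ (p %| N)%N -> P *+ N = Q *+ M -> KZdvd p M (int_ratfun P).
Proof.
move=> N_gt0 pN PQ; exists (N%:R^-1 * int_ratfun Q).
  by apply: KZring_mul; [apply: KZring_natV | apply: KZring_int_ratfun].
have N_neq0 := ratfun_natf_neq0 N_gt0.
apply: (mulfI N_neq0); rewrite mulrCA mulVKf //.
by rewrite !mulr_natl -!rmorphMn PQ.
Qed.

End KZRing.

(** * Coordinates of the right-hand side of the KZ equations *)

Section KZRhs.

Import GRing.Theory.
Local Open Scope ring_scope.
Set Implicit Arguments.
Unset Strict Implicit.

Variables (n : nat).

(** For i != j, [Omega] is -(e_i - e_j)(e_i - e_j)^T. *)
Lemma Omega_mul (F : nzRingType) (i j a : 'I_n) (v : 'cV[F]_n) : i != j ->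
  (Omega F i j *m v) a 0 = ((a == j)%:R - (a == i)%:R) * (v i 0 - v j 0).
Proof.
move=> ij; have ji : j != i by rewrite eq_sym.
rewrite mxE (bigD1 i) //= (bigD1 j) //= big1 => [|b /andP[bi bj]]; last first.
  by rewrite mxE !xpair_eqE (negbTE bi) (negbTE bj) !andbF mul0r.
rewrite !mxE !xpair_eqE !eqxx (negbTE ij) (negbTE ji) !andbF !andbT !orbF addr0.
have [->|] := eqVneq a i.
  by rewrite (negbTE ij) sub0r !mulN1r mul1r opprB addrC.
have [->|aj] := eqVneq a j => ai /=; first by rewrite subr0 mulN1r !mul1r.
by rewrite subr0 !mul0r addr0.
Qed.

Lemma KZrhsE (q : nat) (i a : 'I_n) (v : 'cV[ratfun n]_n) :
  KZrhs q i v a 0 = q%:R^-1 * \sum_(j < n | j != i)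
    (zvar i - zvar j)^-1 * (((a == j)%:R - (a == i)%:R) * (v i 0 - v j 0)).
Proof.
rewrite mxE summxE; congr (_ * _); apply: eq_bigr => j ji.
by rewrite -scalemxAl mxE Omega_mul // eq_sym.
Qed.

(** Away from coordinate i, only the summand j = a reaches coordinate a. *)
Lemma KZrhs_neq (q : nat) (i a : 'I_n) (v : 'cV[ratfun n]_n) : a != i ->
  KZrhs q i v a 0 = q%:R^-1 * ((zvar i - zvar a)^-1 * (v i 0 - v a 0)).
Proof.
move=> ai; rewrite KZrhsE (bigD1 a) //= big1 => [|j /andP[_ ja]].
  by rewrite eqxx (negbTE ai) subr0 mul1r addr0.
by rewrite [a == j]eq_sym (negbTE ja) (negbTE ai) subr0 mul0r mulr0.
Qed.

(** Each summand j contributes opposite amounts to coordinates i and j. *)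
Lemma KZrhs_sum (q : nat) (i : 'I_n) (v : 'cV[ratfun n]_n) :
  \sum_a KZrhs q i v a 0 = 0.
Proof.
under eq_bigr => a _ do rewrite KZrhsE.
rewrite -mulr_sumr exchange_big big1 ?mulr0 // => j _.
rewrite -mulr_sumr -mulr_suml sumrB.
have delta1 (k : 'I_n) : \sum_a (a == k)%:R = 1 :> ratfun n.
  by rewrite (bigD1 k) //= eqxx big1 ?addr0 // => a /negbTE->.
by rewrite !delta1 subrr mul0r mulr0.
Qed.

End KZRhs.

(** * Derivatives of the master polynomial in t and in the z_i *)

Section MasterPolynomial.

Import GRing.Theory.
Local Open Scope ring_scope.
Set Implicit Arguments.
Unset Strict Implicit.

(** Induction with the product rule; [uniq] makes the filter [k != a] drop exactly one factor. *)
Lemma deriv_prod_uniq (R : comNzRingType) (I : eqType) (r : seq I)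
    (F : I -> {poly R}) : uniq r ->
  (\prod_(i <- r) F i)^`()
    = \sum_(a <- r) (F a)^`() * \prod_(k <- r | k != a) F k.
Proof.
elim: r => [|x r IHr] /=; first by rewrite !big_nil derivC.
move=> /andP[xr /IHr {}IHr]; rewrite !big_cons derivM IHr eqxx /=; congr (_ + _).
  congr (_ * _); rewrite big_seq [RHS]big_seq_cond; apply: eq_bigl => k.
  by case: (boolP (k \in r)) => //= kr; apply/esym; apply: contraNneq xr => <-.
rewrite mulr_sumr; apply: eq_big_seq => a ar.
rewrite big_cons ifT; last by apply: contraNneq xr => ->.
by rewrite mulrCA.
Qed.

(** Meant for x = t - z_i, with y and r free of z_i: it isolates the dependence on z_i. *)
Lemma mul_expM3 (R : comNzRingType) (x y r : R) (m : nat) :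
  r * (y * x * r) ^+ m = x ^+ m * (r ^+ m.+1 * y ^+ m).
Proof. by rewrite !exprMn exprS; ring. Qed.

Variables (n : nat).

Implicit Types (i a : 'I_n) (P Q : {poly {mpoly int[n]}}).

Local Notation tz i := ('X - ('X_i)%:P : {poly {mpoly int[n]}}).
Local Notation "''D_' i" := (map_poly (@mderiv n int i))
  (at level 8, i at level 2).

(** [mderiv] is a derivation, not a ring morphism, so the product rule is checked on the convolution
    formula for coefficients. *)
Lemma mapderivM i P Q : 'D_i (P * Q) = 'D_i P * Q + P * 'D_i Q.
Proof.
apply/polyP => k; rewrite coef_map !coefE !coefM raddf_sum -big_split.
by apply: eq_bigr => j _ /=; rewrite mderivM !coef_map.
Qed.

Lemma mapderivX i P (k : nat) : 'D_i (P ^+ k.+1) = 'D_i P * P ^+ k *+ k.+1.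
Proof.
elim: k => [|k IHk]; first by rewrite expr1 expr0 mulr1.
by rewrite exprS mapderivM IHk mulrnAr mulrCA -exprS [RHS]mulrS.
Qed.

Lemma mapderivX0 i P (k : nat) : 'D_i P = 0 -> 'D_i (P ^+ k) = 0.
Proof.
case: k => [|k] DP; last by rewrite mapderivX DP mul0r mul0rn.
by rewrite expr0 -polyC1 map_polyC /= mderivC.
Qed.

Lemma mderiv_var i a : ('X_a : {mpoly int[n]})^`M(i) = (i == a)%:R.
Proof.
rewrite mderivX mnm1E eq_sym; case: eqVneq => [->|_]; last exact: scale0r.
by rewrite -{1}[U_(a)%MM]add0m addmK mpolyX0 scale1r.
Qed.

Lemma mapderiv_tz i a : 'D_i (tz a) = - (i == a)%:R.
Proof.
have DX : 'D_i 'X = 0.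
  apply/polyP => k; rewrite coef_map coefX coef0 /=.
  by rewrite -mpolyC_nat mderivC.
by rewrite raddfB /= DX sub0r map_polyC /= mderiv_var polyC_natr.
Qed.

(** Phi / (t - z_a) for Phi of exponent m + 1, written without division. *)
Definition cofactor (m : nat) a : {poly {mpoly int[n]}} :=
  (\prod_(k < n | k != a) tz k) * master n m.

Lemma master_divp (m : nat) a : master n m.+1 %/ tz a = cofactor m a.
Proof.
rewrite /master exprS {1}(bigD1 a) //= -mulrA.
by rewrite Pdiv.IdomainMonic.mulKp ?monicXsubC.
Qed.

Lemma deriv_master (m : nat) :
  (master n m.+1)^`() = (\sum_a cofactor m a) *+ m.+1.
Proof.
rewrite deriv_exp deriv_prod_uniq ?index_enum_uniq //= mulr_suml.
by congr (_ *+ _); apply: eq_bigr => a _; rewrite derivXsubC mul1r.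
Qed.

(* The witness is [Phi / ((t - z_i) (t - z_a))]. *)
Lemma cofactor_split (m : nat) i a : a != i ->
  exists B, [/\ cofactor m a = tz i * B, cofactor m i = tz a * B
              & 'D_i (cofactor m a) = - (B *+ m.+1)].
Proof.
move=> ai; have ia : i != a by rewrite eq_sym.
pose R := \prod_(k < n | (k != a) && (k != i)) tz k.
have aE : \prod_(k < n | k != a) tz k = tz i * R by rewrite (bigD1 i ia).
have iE : \prod_(k < n | k != i) tz k = tz a * R.
  by rewrite (bigD1 a ai); congr (_ * _); apply: eq_bigl => k; rewrite andbC.
have mE : master n m = (tz a * tz i * R) ^+ m.
  by rewrite /master (bigD1 a) //= aE mulrA.
exists (R * master n m); split; rewrite /cofactor ?aE ?iE ?mulrA //.
have DR : 'D_i R = 0.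
  rewrite /R; elim/big_ind: _ => [|P Q DP DQ|k /andP[_ ki]].
  - exact: (mapderivX0 (P := 0) 0 (raddf0 _)).
  - by rewrite mapderivM DP DQ mul0r mulr0 addr0.
  - by rewrite mapderiv_tz eq_sym (negbTE ki) oppr0.
(* The cofactor becomes (t - z_i)^(m+1) times a factor that [DC] shows to be constant in z_i. *)
rewrite -mulrA mE mul_expM3 [tz i * (_ * _)]mulrA -exprS.
have DC : 'D_i (R ^+ m.+1 * tz a ^+ m) = 0.
  rewrite mapderivM (mapderivX0 _ DR) mapderivX0 ?mul0r ?mulr0 ?addr0 //.
  by rewrite mapderiv_tz (negbTE ia) oppr0.
rewrite mapderivM mapderivX DC mulr0 addr0 mapderiv_tz eqxx.
by rewrite mulN1r mulNrn mulNr mulrnAl.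
Qed.

(** * Passage to the coefficient of t^K *)

Section Coefficients.

Variables (m K : nat).
Let v : 'cV[{mpoly int[n]}]_n := \col_a (cofactor m a)`_K.

Lemma coef_cofactor_split i a : a != i ->
  exists b, v i 0 - v a 0 = ('X_i - 'X_a) * b /\ (v a 0)^`M(i) = - (b *+ m.+1).
Proof.
move=> /(cofactor_split m)[B [aE iE DE]]; exists B`_K; split.
  (* The t's cancel, so this factor is constant in t and leaves the coefficient. *)
  have zE : tz a - tz i = ('X_i - 'X_a)%:P.
    by rewrite polyCB opprB addrC addrA subrK.
  by rewrite !mxE aE iE -coefB -mulrBl zE coefCM.
have := coef_map (@mderiv n int i) (cofactor m a) K.
by rewrite DE !coefE mxE => ->.
Qed.

(** Differentiation in t brings down the factor K + 1; the choice K = l M - 1 makes it a multiple of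
    M. *)
Lemma coef_cofactor_sum (k : nat) : K.+1 = k ->
  (\sum_a v a 0) *+ m.+1 = (master n m.+1)`_k *+ k.
Proof.
move=> <-; rewrite -coef_deriv deriv_master coefMn coef_sum.
by congr (_ *+ _); apply: eq_bigr => a _; rewrite mxE.
Qed.

Lemma KZ_solution_cofactor (p q M l : nat) : prime p -> (0 < q)%N ->
  ~~ (p %| q)%N -> (p %| M)%N -> M = (q * m.+1).+1 -> K.+1 = (l * M)%N ->
  KZ_solution_mod p q M v.
Proof.
move=> p_prime q_gt0 pq pM ME KE.
have q_neq0 := ratfun_natf_neq0 n q_gt0.
(* If p divided N = m + 1, it would divide M - q N = 1. *)
have pN : ~~ (p %| m.+1)%N.
  apply/negP => pN; have := pM; rewrite ME -addn1 dvdn_addr ?dvdn_mull //.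
  by rewrite dvdn1; apply/negP; rewrite neq_ltn prime_gt1 ?orbT.
have sumE : (\sum_a v a 0) *+ m.+1 = ((master n m.+1)`_(l * M) *+ l) *+ M.
  by rewrite -mulrnA; apply: coef_cofactor_sum.
split; last by apply: KZdvd_int_ratfun sumE.
move=> i; set w := map_mx _ v.
have wE a : w a 0 = int_ratfun (v a 0) by rewrite mxE.
pose diff a := int_ratfun (v a 0)^`M(i) - KZrhs q i w a 0.
have diff_neq a : a != i -> KZdvd p M (diff a).
  move=> ai; have [b [vE DE]] := coef_cofactor_split ai.
  have z_neq0 : zvar i - zvar a != 0 by rewrite zvar_sub_neq0 // eq_sym.
  exists (- (q%:R^-1 * int_ratfun b)).
    apply: KZring_opp => //; apply: KZring_mul; first exact: KZring_natV.
    exact: KZring_int_ratfun.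
  rewrite /diff KZrhs_neq // !wE -[int_ratfun (v i 0) - _]rmorphB vE.
  rewrite rmorphM rmorphB /= !int_ratfun_var.
  rewrite mulKf // DE rmorphN rmorphMn /= ME.
  rewrite mulrN -[(q * _).+1]addn1 natrD mulrDl mul1r opprD mulnC natrM -mulrA.
  by rewrite (mulVKf q_neq0) mulr_natl.
(* The right-hand sides cancel in the total, leaving the derivative of the sum controlled by
   [sumE]. *)
have sum_diff : \sum_a diff a = int_ratfun (\sum_a v a 0)^`M(i).
  by rewrite sumrB KZrhs_sum subr0 [_^`M(i)]raddf_sum rmorph_sum.
move=> a; rewrite -/(diff a); have [->|] := eqVneq a i; last exact: diff_neq.
have -> : diff i = \sum_a diff a - \sum_(a | a != i) diff a.
  by rewrite [in X in X - _](bigD1 i) //= addrK.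
apply: KZdvd_add; last by apply: KZdvd_opp => //; apply: KZdvd_sum.
(* Differentiating [sumE] in z_i preserves its shape N P = M Q. *)
rewrite sum_diff; apply: KZdvd_int_ratfun pN _ => //.
by rewrite -mderivMn sumE mderivMn.
Qed.

End Coefficients.

End MasterPolynomial.

Theorem theorem5p1 (p q e g n : nat)
  (p_prime : prime p) (q_prime : prime q) (q_lt_p : q < p) (p_odd : odd p)
  (e_order : is_order_mod q p e)
  (g_gt0 : 0 < g) (n_def : n = g * q + 1)
  (n_lt : n < p ^ e) (p_ge : n + q - 2 <= p)
  (s l : nat) (s_ge1 : 1 <= s) (l_ge1 : 1 <= l) (l_le : l <= g) :
  KZ_solution_mod p q (p ^ (e * s)) (Ivec n p q e s l).
Proof.
have [e_gt0 pe1 _] := e_order.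
have M1 : p ^ (e * s) = 1 %[mod q] by rewrite expnM -modnXm pe1 modnXm exp1n.
have M_gt1 : 1 < p ^ (e * s).
  by rewrite -(exp1n (e * s)) ltn_exp2r ?prime_gt1 // muln_gt0 e_gt0.
have qM : q %| p ^ (e * s) - 1.
  by rewrite -eqn_mod_dvd ?(ltnW M_gt1) //; apply/eqP.
(* Positivity lets the exponent be written as [m.+1], the form [cofactor] needs. *)
have : 0 < (p ^ (e * s) - 1) %/ q.
  by rewrite divn_gt0 ?prime_gt0 // dvdn_leq // subn_gt0.
case NE: (_ %/ q) => [//|m] _.
have -> : Ivec n p q e s l =
    (\col_a (cofactor m a)`_(l * p ^ (e * s) - 1))%R.
  by apply/matrixP => a b; rewrite !mxE /Phi NE master_divp.
apply: KZ_solution_cofactor => //.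
- exact: prime_gt0.
- by rewrite gtnNdvd ?prime_gt0.
- by rewrite dvdn_exp // muln_gt0 e_gt0.
- by rewrite -NE [q * _]mulnC divnK // subn1 prednK // ltnW.
(* The truncated subtraction is undone by adding 1, because l p^(es) is positive. *)
- by rewrite subn1 prednK // muln_gt0 l_ge1 ltnW.
Qed.
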